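(* Let $\mathbb{O}=(W,(\cdot|\cdot),\wedge)$ be the real Cayley–Dickson octonion division algebra and let $s$ be a positive definite symmetric automorphism of the Euclidean space $(W,-(\cdot|\cdot))$. Then the following two properties are equivalent: (1) The automorphism group $\mathrm{Aut}(\mathbb{O}(s))$ is not trivial. (2) $\widetilde{s}$ leaves stable some subalgebra of $\mathbb{O}$ of dimension $4$.
   Context: For an anticommutative bilinear product $\ast$ and a symmetric bilinear form $(\cdot|\cdot)$ on a real vector space $W$, $(W,(\cdot|\cdot),\ast)$ denotes the real algebra $\mathbb{R}1\oplus W$ with product $(\alpha+x)(\beta+y)=(\alpha\beta+(x|y))+(\alpha y+\beta x+x\ast y)$. The octonion division algebra $\mathbb{O}$ is of this form with $W$ the 7-dimensional space of purely imaginary octonions, $(x|y)$ the scalar part and $x\wedge y$ the imaginary part of $xy$; here $(\cdot|\cdot)$ is negative definite. For a linear automorphism $\varphi$ of $W$, with adjoint $\varphi^*$ for $(\cdot|\cdot)$, $\mathbb{O}(\varphi)=(W,(\cdot|\cdot),\Delta)$ with $x\Delta y=\varphi^*(\varphi(x)\wedge\varphi(y))$ (for symmetric $s$, $s^*=s$). $\widetilde s:\mathbb{R}1\oplus W\to\mathbb{R}1\oplus W$ is the extension $\alpha+u\mapsto\alpha+s(u)$. $\mathrm{Aut}$ denotes the group of algebra automorphisms. *)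

(* Defs.v *)
From HB Require Import structures.
From mathcomp Require Import all_boot all_order all_algebra.
From mathcomp Require Import boolp classical_sets reals.

Set Implicit Arguments.
Unset Strict Implicit.
Unset Printing Implicit Defensive.

Import Order.TTheory GRing.Theory Num.Theory.
Local Open Scope ring_scope.
Local Open Scope classical_set_scope.

(* Cayley-Dickson doubling; pairs carry this product, not the componentwise
   one of the library:
   (a, b) (c, d) = (a c - d^* b, d a + b c^* ),  (a, b)^* = (a^*, - b). *)
Section CayleyDickson.
Context {A : zmodType}.
Variables (mul : A -> A -> A) (conj : A -> A).

Definition cd_mul (x y : A * A) : A * A :=
  (mul x.1 y.1 - mul (conj y.2) x.2, mul y.2 x.1 + mul x.2 (conj y.1)).

Definition cd_conj (x : A * A) : A * A := (conj x.1, - x.2).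

End CayleyDickson.

Section Octonions.
Variable R : realType.

Definition cplx : vectType R := (R^o * R^o)%type.
Definition quat : vectType R := (cplx * cplx)%type.
Definition octo : vectType R := (quat * quat)%type.

Definition cplx_conj : cplx -> cplx := cd_conj id.
Definition cplx_mul : cplx -> cplx -> cplx := cd_mul *%R id.
Definition quat_conj : quat -> quat := cd_conj cplx_conj.
Definition quat_mul : quat -> quat -> quat := cd_mul cplx_mul cplx_conj.
Definition octo_mul : octo -> octo -> octo := cd_mul quat_mul quat_conj.

Definition octo1 : octo := (((1, 0), 0), 0).

Definition octo_re (x : octo) : R := x.1.1.1.

Definition imO_vs : {vspace octo} :=
  lker (linfun ((fst \o fst) \o fst : octo -> R^o)).
Definition imO : vectType R := subvs_of imO_vs.

(* [vsproj] is only meaningful on [imO_vs], hence the explicit subtraction. *)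
Definition octo_im (x : octo) : imO := vsproj imO_vs (x - octo_re x *: octo1).

Definition oform (x y : imO) : R := octo_re (octo_mul (vsval x) (vsval y)).
Definition owedge (x y : imO) : imO := octo_im (octo_mul (vsval x) (vsval y)).

End Octonions.

Section QuadraticAlgebra.
Context {R : realType} {W : vectType R}.
Variables (form : W -> W -> R) (star : W -> W -> W).

Definition qcarrier : vectType R := (R^o * W)%type.

(* (a + x)(b + y) = (ab + (x|y)) + (a y + b x + x * y), with a + x encoded as
   the pair (a, x). *)
Definition qmul (x y : qcarrier) : qcarrier :=
  (x.1 * y.1 + form x.2 y.2, x.1 *: y.2 + y.1 *: x.2 + star x.2 y.2).

(* Unique when the form is nondegenerate; the default 0 is only taken when no
   adjoint exists. *)
Definition adjoint (f : 'End(W)) : 'End(W) :=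
  xget 0 [set g : 'End(W) | forall x y, form (f x) y = form x (g y)].

Definition twist (f : 'End(W)) (x y : W) : W :=
  adjoint f (star (f x) (f y)).

Definition ext (f : 'End(W)) (x : qcarrier) : qcarrier := (x.1, f x.2).

End QuadraticAlgebra.

Section Algebra.
Context {R : realType} {A : vectType R}.
Variable mul : A -> A -> A.

(* In finite dimension, a trivial kernel is the same as bijectivity. *)
Definition Aut : set 'End(A) :=
  [set f | lker f = 0%VS /\ {morph f : x y / mul x y}].

(* Not required to contain a unit. *)
Definition subalgebra (U : {vspace A}) : Prop :=
  forall x y, x \in U -> y \in U -> mul x y \in U.

End Algebra.

Section Symmetric.
Context {R : realType} {W : vectType R}.
Variable dot : W -> W -> R.

Definition symmetric_end (f : 'End(W)) : Prop :=
  forall x y, dot (f x) y = dot x (f y).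

Definition posdef_end (f : 'End(W)) : Prop :=
  forall x, x != 0 -> 0 < dot (f x) x.

End Symmetric.

(* Main.v *)
(* Im O with <x, y> = - (x|y) and the product of imaginary parts is a
   7-dimensional inner product space with a cross product, and (2) amounts to
   the existence of a 3-dimensional s-stable subspace F closed under the cross
   product.  Given F, the map equal to 1 on F and to -1 on its orthogonal
   complement is an automorphism of O commuting with s, hence an automorphism
   of O(s).

   Conversely, an automorphism of O(s) is 1 + sigma with sigma an isometry of
   Im O.  The squared determinant of the left multiplication by x in O(s) is a
   constant times <x, x>^4 <s x, s x>^4, so sigma preserves <s x, s x>; thus
   sigma commutes with s^2, hence with its positive square root s, and sigma is
   an automorphism of O.  A suitable F is then found among the fixed vectors of
   sigma or spanned by v, sigma v and their product, for a common eigenvector v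
   of s and sigma + sigma^-1. *)

Require Import Defs.
From HB Require Import structures.
From mathcomp Require Import all_boot all_order all_algebra.
From mathcomp Require Import boolp classical_sets reals.
From mathcomp Require Import ring lra zify.
From mathcomp Require complex.

Set Implicit Arguments.
Unset Strict Implicit.
Unset Printing Implicit Defensive.

Import Order.TTheory GRing.Theory Num.Theory.
Local Open Scope ring_scope.
Local Open Scope classical_set_scope.

(** Serves for functions whose linearity is only a proved fact, such as products with a fixed
    vector. *)
Lemma linfunE {R : realType} {U V : vectType R} (f : U -> V) :
  linear f -> linfun f =1 f.
Proof.
move=> lf; pose m := GRing.isLinear.Build _ _ _ _ f lf.
by pose g : {linear U -> V} := HB.pack f m; exact: (lfunE g).
Qed.

(** * Inner product spaces *)

Section InnerProduct.
Context {R : realType} {W : vectType R}.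

Record inner_product (dot : W -> W -> R) : Prop := InnerProduct {
  inner_sym : forall x y, dot x y = dot y x;
  inner_linear : forall a x y z, dot (a *: x + y) z = a * dot x z + dot y z;
  inner_gt0 : forall x, x != 0 -> 0 < dot x x
}.

Variable dot : W -> W -> R.
Hypothesis dotP : inner_product dot.

Lemma dotC x y : dot x y = dot y x. Proof. exact: inner_sym. Qed.

Lemma dotDl x y z : dot (x + y) z = dot x z + dot y z.
Proof. by have := inner_linear dotP 1 x y z; rewrite scale1r mul1r. Qed.

Lemma dot0l z : dot 0 z = 0.
Proof. by apply: (addrI (dot 0 z)); rewrite -dotDl !addr0. Qed.

Lemma dotZl a x z : dot (a *: x) z = a * dot x z.
Proof. by have := inner_linear dotP a x 0 z; rewrite dot0l !addr0. Qed.

Lemma dotNl x z : dot (- x) z = - dot x z.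
Proof. by rewrite -scaleN1r dotZl mulN1r. Qed.

Lemma dotBl x y z : dot (x - y) z = dot x z - dot y z.
Proof. by rewrite dotDl dotNl. Qed.

Lemma dotDr x y z : dot z (x + y) = dot z x + dot z y.
Proof. by rewrite !(dotC z) dotDl. Qed.

Lemma dot0r z : dot z 0 = 0. Proof. by rewrite dotC dot0l. Qed.

Lemma dotZr a x z : dot z (a *: x) = a * dot z x.
Proof. by rewrite !(dotC z) dotZl. Qed.

Lemma dotNr x z : dot z (- x) = - dot z x.
Proof. by rewrite !(dotC z) dotNl. Qed.

Lemma dotBr x y z : dot z (x - y) = dot z x - dot z y.
Proof. by rewrite !(dotC z) dotBl. Qed.

Definition dotE :=
  (dotDl, dotDr, dotBl, dotBr, dotNl, dotNr, dotZl, dotZr, dot0l, dot0r).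

Lemma dot_ge0 x : 0 <= dot x x.
Proof.
by have [->|/(inner_gt0 dotP)/ltW//] := eqVneq x 0; rewrite dot0l.
Qed.

Lemma dot_eq0 x : (dot x x == 0) = (x == 0).
Proof.
have [->|x0] := eqVneq x 0; first by rewrite dot0l eqxx.
exact/negbTE/lt0r_neq0/(inner_gt0 dotP).
Qed.

Lemma dot_inj x y : (forall z, dot x z = dot y z) -> x = y.
Proof.
by move=> e; apply/eqP; rewrite -subr_eq0 -dot_eq0 dotBl e subrr.
Qed.

Import complex VectorInternalTheory.

(* An eigenvalue over R[i] is real, because the real and imaginary parts x, y
   of an eigenvector satisfy <f x, y> = <x, f y>. *)
Lemma symmetric_eigenvector (f : 'End(W)) :
  symmetric_end dot f -> (0 < \dim {:W})%N ->
  exists c v, v != 0 /\ f v = c *: v.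
Proof.
move=> fS W0; rewrite dimvf in W0.
pose A := f2mx f.
have [c /eigenvalueP[z zA z0]] := eigenvalue_closed (map_mx (real_complex R) A) W0.
have ReD : {morph (@Re R) : a b / a + b >-> a + b} by do 2!case=> ? ?.
have ImD : {morph (@Im R) : a b / a + b >-> a + b} by do 2!case=> ? ?.
pose x := map_mx (@Re R) z; pose y := map_mx (@Im R) z.
(* The entries of [A] are real, so z A = c z splits into its real and imaginary parts. *)
have xA : x *m A = Re c *: x - Im c *: y.
  apply/rowP => j; move/rowP/(_ j)/(congr1 (@Re R)): zA.
  rewrite !mxE (big_morph (@Re R) ReD (erefl _)) => zA.
  under eq_bigr => i _ do rewrite !mxE.
  transitivity (Re (c * z 0 j)); last by case: (c) (z 0 j) => ? ? [].
  by rewrite -zA; apply: eq_bigr => i _; rewrite !mxE; case: (z 0 i) => ? ? /=; ring.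
have yA : y *m A = Im c *: x + Re c *: y.
  apply/rowP => j; move/rowP/(_ j)/(congr1 (@Im R)): zA.
  rewrite !mxE (big_morph (@Im R) ImD (erefl _)) => zA.
  under eq_bigr => i _ do rewrite !mxE.
  transitivity (Im (c * z 0 j)); last by case: (c) (z 0 j) => ? ? [? ?] /=; ring.
  by rewrite -zA; apply: eq_bigr => i _; rewrite !mxE; case: (z 0 i) => ? ? /=; ring.
have fr2v u : f (r2v u) = r2v (u *m A).
  by rewrite unlock /= r2vK.
pose X : W := r2v x; pose Y : W := r2v y.
have fX : f X = Re c *: X - Im c *: Y by rewrite fr2v xA linearB !linearZ.
have fY : f Y = Im c *: X + Re c *: Y by rewrite fr2v yA linearD !linearZ.
have XY0 : (X != 0) || (Y != 0).
  apply: contra_neqT z0; rewrite negb_or !negbK => /andP[/eqP X0 /eqP Y0].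
  have x0 : x = 0 by apply: r2v_inj; rewrite linear0.
  have y0 : y = 0 by apply: r2v_inj; rewrite linear0.
  apply/rowP => j; move/rowP/(_ j): x0; move/rowP/(_ j): y0.
  by rewrite !mxE; case: (z 0 j) => ? ? /= -> ->.
have c0 : Im c = 0.
  have XY : 0 < dot X X + dot Y Y.
    by case/orP: XY0 => /(inner_gt0 dotP) h;
      [apply: ltr_pwDl|apply: ltr_pwDr] => //; apply: dot_ge0.
  apply/eqP; have /eqP : Im c * (dot X X + dot Y Y) = 0.
    have := fS X Y; rewrite fX fY !dotE => e.
    by rewrite mulrDr; lra.
  by rewrite mulf_eq0 (gt_eqF XY) orbF.
rewrite c0 !scale0r ?subr0 ?add0r in fX fY.
by case/orP: XY0 => nz; exists (Re c); [exists X|exists Y].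
Qed.

(** Encoded as the kernel of the products with a basis of V, so that rank-nullity bounds its
    codimension by dim V. *)
Definition orthv (V : {vspace W}) : {vspace W} :=
  lker (linfun (fun x : W => \row_(i < \dim V) dot x (vbasis V)`_i)).

Lemma mem_orthv (V : {vspace W}) x :
  x \in orthv V <-> forall y, y \in V -> dot x y = 0.
Proof.
rewrite memv_ker linfunE; last first.
  by move=> a u v; apply/rowP => i; rewrite !mxE !dotE.
split=> [/eqP/rowP x0 y /coord_vbasis ->|x0].
  have dot_sum : {morph dot x : u v / u + v >-> u + v} by move=> u v; rewrite dotE.
  rewrite (big_morph _ dot_sum (dot0r x)) big1// => i _.
  by have := x0 i; rewrite !mxE dotZr => ->; rewrite mulr0.
apply/eqP/rowP => i; rewrite !mxE x0// vbasis_mem// mem_nth//.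
by rewrite size_tuple.
Qed.

Lemma orthv_cap (V : {vspace W}) : (V :&: orthv V = 0)%VS.
Proof.
apply/eqP; rewrite -subv0; apply/subvP => x /memv_capP[xV /mem_orthv xo].
by rewrite memv0 -dot_eq0 xo.
Qed.

(** The sum is direct, and the kernel defining [orthv] has codimension at most dim V, so the
    dimensions add up to at least that of W. *)
Lemma addv_orthv (V : {vspace W}) : (V + orthv V = fullv)%VS.
Proof.
apply/eqP; rewrite eqEdim subvf dimv_disjoint_sum ?orthv_cap//=.
rewrite -(limg_ker_dim (linfun (fun x : W => \row_(i < \dim V) dot x (vbasis V)`_i))).
rewrite capfv addnC leq_add2r.
by apply: (leq_trans (dimvS (subvf _))); rewrite dimvf dim_matrix -[leqRHS]mul1n.
Qed.

Lemma dim_orthv (V : {vspace W}) : (\dim V + \dim (orthv V) = \dim {:W})%N.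
Proof. by rewrite -(addv_orthv V) dimv_disjoint_sum ?orthv_cap. Qed.

End InnerProduct.

(** * Symmetric operators: stable subspaces and positive square roots *)

Section SymmetricOperators.
Context {R : realType} {W : vectType R}.
Variable dot : W -> W -> R.
Hypothesis dotP : inner_product dot.

Lemma symmetric_eigenvector_in (f : 'End(W)) (V : {vspace W}) :
  symmetric_end dot f -> (forall x, x \in V -> f x \in V) -> V != 0%VS ->
  exists c v, [/\ v \in V, v != 0 & f v = c *: v].
Proof.
move=> fS fV V0.
(* The induced product and the restriction of f live on the subspace type, where
   [symmetric_eigenvector] applies. *)
pose d (x y : subvs_of V) := dot (vsval x) (vsval y).
have dP : inner_product d.
  split=> [x y|a x y z|x x0]; rewrite /d; first exact: (dotC dotP).
    by rewrite linearP (inner_linear dotP).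
  by apply: (inner_gt0 dotP); rewrite -(inj_eq subvs_inj) linear0 in x0.
pose g : 'End(subvs_of V) := linfun (vsproj V \o f \o vsval).
have gE x : vsval (g x) = f (vsval x).
  by rewrite lfunE /= vsprojK ?fV ?subvsP.
have [||c [v [v0 gv]]] := symmetric_eigenvector dP (f := g).
  by move=> x y; rewrite /d !gE fS.
  by rewrite dimvf /= lt0n dimv_eq0.
exists c, (vsval v); split; first exact: subvsP.
  by rewrite -(inj_eq subvs_inj) linear0 in v0.
by rewrite -gE gv linearZ.
Qed.

(* With d = s - t, s d + d t = 0, so an eigenvector v of d for mu satisfies
   mu (<s v, v> + <t v, v>) = 0; the restriction of d to its image thus has no
   nonzero eigenvalue, whereas ker d is orthogonal to im d. *)
Lemma posdef_sqrt_unique (s t : 'End(W)) :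
  symmetric_end dot s -> posdef_end dot s ->
  symmetric_end dot t -> posdef_end dot t ->
  (forall x, s (s x) = t (t x)) -> s = t.
Proof.
move=> sS sP tS tP st; pose d := s - t.
have dE x : d x = s x - t x by rewrite add_lfunE opp_lfunE.
have dS : symmetric_end dot d.
  by move=> x y; rewrite !dE !(dotE dotP) sS tS.
apply/eqP; rewrite -subr_eq0 -/d; apply/negPn/negP => d0.
have [||c [v [/memv_imgP[w _ vE] v0 dv]]] := symmetric_eigenvector_in (V := limg d) dS.
- by move=> x _; rewrite memv_img ?memvf.
- apply: contra_neq d0 => d0; apply/lfunP => x; rewrite zero_lfunE.
  by apply/eqP; rewrite -memv0 -d0 memv_img ?memvf.
have /eqP : c * (dot (s v) v + dot (t v) v) = 0.
  transitivity (dot (s v) (d v) + dot (d v) (t v)).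
    by rewrite dv !(dotE dotP) mulrDr [dot (t v) v](dotC dotP).
  rewrite sS dS -(dotDr dotP) !dE linearB/= st addrA subrK subrr.
  exact: dot0r dotP _.
rewrite mulf_eq0 [X in _ || X]gt_eqF ?orbF; last by rewrite addr_gt0 ?sP ?tP.
move=> /eqP c0; move: v0; rewrite -(dot_eq0 dotP) {1}vE dS dv c0 scale0r.
by rewrite (dot0r dotP) eqxx.
Qed.

End SymmetricOperators.

(** * Cross products *)

Section CrossProduct.
Context {R : realType} {W : vectType R}.

(** Given the other axioms, [cross_double] amounts to |cross x y|^2 = |x|^2 |y|^2 - <x, y>^2, that
    is, to the multiplicativity of the norm on R1 + W. *)
Record cross_product (dot : W -> W -> R) (cross : W -> W -> W) : Prop :=
  CrossProduct {
    cross_inner : inner_product dot;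
    cross_linear : forall a x y z,
      cross (a *: x + y) z = a *: cross x z + cross y z;
    cross_anti : forall x y, cross x y = - cross y x;
    cross_orth : forall x y, dot (cross x y) x = 0;
    cross_double : forall x y,
      cross x (cross x y) = dot x y *: x - dot x x *: y
  }.

Variables (dot : W -> W -> R) (cross : W -> W -> W).
Hypothesis crossP : cross_product dot cross.
Let dotP : inner_product dot := cross_inner crossP.

Lemma crossNC x y : cross x y = - cross y x. Proof. exact: cross_anti crossP x y. Qed.

Lemma crossDl x y z : cross (x + y) z = cross x z + cross y z.
Proof. by have := cross_linear crossP 1 x y z; rewrite !scale1r. Qed.

Lemma cross0l z : cross 0 z = 0.
Proof. by apply: (addrI (cross 0 z)); rewrite -crossDl !addr0. Qed.

Lemma crossZl a x z : cross (a *: x) z = a *: cross x z.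
Proof. by have := cross_linear crossP a x 0 z; rewrite cross0l !addr0. Qed.

Lemma crossNl x z : cross (- x) z = - cross x z.
Proof. by rewrite -scaleN1r crossZl scaleN1r. Qed.

Lemma crossBl x y z : cross (x - y) z = cross x z - cross y z.
Proof. by rewrite crossDl crossNl. Qed.

Lemma crossDr x y z : cross z (x + y) = cross z x + cross z y.
Proof. by rewrite crossNC crossDl opprD -(crossNC z x) -(crossNC z y). Qed.

Lemma cross0r z : cross z 0 = 0.
Proof. by rewrite crossNC cross0l oppr0. Qed.

Lemma crossZr a x z : cross z (a *: x) = a *: cross z x.
Proof. by rewrite crossNC crossZl -scalerN -crossNC. Qed.

Lemma crossNr x z : cross z (- x) = - cross z x.
Proof. by rewrite crossNC crossNl -crossNC. Qed.

Lemma crossBr x y z : cross z (x - y) = cross z x - cross z y.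
Proof. by rewrite crossDr crossNr. Qed.

Definition crossE := (crossDl, crossDr, crossBl, crossBr, crossNl, crossNr,
  crossZl, crossZr, cross0l, cross0r).

Lemma crossxx x : cross x x = 0.
Proof.
apply/eqP; have /eqP := crossNC x x.
by rewrite -addr_eq0 -mulr2n -scaler_nat scaler_eq0 pnatr_eq0.
Qed.

Lemma cross_orthr x y : dot (cross x y) y = 0.
Proof. by rewrite crossNC (dotNl dotP) (cross_orth crossP) oppr0. Qed.

(** Polarisation of [cross_orth], evaluated at x + z. *)
Lemma cross_triple x y z : dot (cross x y) z = dot x (cross y z).
Proof.
have := cross_orth crossP (x + z) y.
rewrite crossDl !(dotE dotP) !(cross_orth crossP) add0r addr0 => /eqP.
by rewrite addr_eq0 => /eqP ->; rewrite (crossNC z) (dotNl dotP) opprK (dotC dotP).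
Qed.

(** By [cross_double], <x, x> y = <x, y> x. *)
Lemma cross_eq0 x y : x != 0 -> cross x y = 0 -> exists a, y = a *: x.
Proof.
move=> x0 xy; have := cross_double crossP x y; rewrite xy cross0r => /eqP.
rewrite eq_sym subr_eq0 => /eqP e; exists ((dot x x)^-1 * dot x y).
by rewrite -scalerA e scalerA mulVf ?scale1r// (dot_eq0 dotP).
Qed.

Definition cross_end (c : W) : 'End(W) := linfun (cross c).

Lemma cross_endE c x : cross_end c x = cross c x.
Proof. by rewrite linfunE// => a u v; rewrite crossDr crossZr. Qed.

Definition cross_closed (F : {vspace W}) : Prop :=
  forall x y, x \in F -> y \in F -> cross x y \in F.

(** This is the Cayley-Dickson doubling of R1 + F by c. Orthogonality to F is <cross c x, y> = <c,
    cross x y> = 0; on F, the map [cross c] is injective because a multiple of c in F vanishes, and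
    its image is orthogonal to c. *)
Lemma cross_closed_orth (F : {vspace W}) c
    (G := (<[c]> + cross_end c @: F)%VS) :
  cross_closed F -> c \in orthv dot F -> c != 0 ->
  (G <= orthv dot F)%VS /\ \dim G = (\dim F).+1.
Proof.
move=> Fc co c0; have /(mem_orthv dotP) cF := co; split.
  rewrite subv_add -memvE co; apply/subvP => _ /memv_imgP[x xF ->].
  apply/(mem_orthv dotP) => y yF.
  by rewrite cross_endE cross_triple cF ?Fc.
have dF : \dim (cross_end c @: F) = \dim F.
  apply: limg_dim_eq; apply/eqP; rewrite -subv0; apply/subvP => x.
  case/memv_capP => xF; rewrite memv_ker cross_endE => /eqP /(cross_eq0 c0)[a xa].
  by rewrite memv0 -(dot_eq0 dotP) {1}xa (dotZl dotP) cF// mulr0.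
rewrite dimv_disjoint_sum ?dF ?dim_vline ?c0//.
apply/eqP; rewrite -subv0; apply/subvP => _ /memv_capP[/vlineP[a ->]].
case/memv_imgP=> x xF e; rewrite memv0 -(dot_eq0 dotP) {1}e (dotZr dotP).
by rewrite cross_endE (cross_orth crossP) mulr0.
Qed.

(** The space G of [cross_closed_orth] fits into the complement of F. In dimension 7 a proper closed
    subspace thus has dimension at most 3. *)
Lemma cross_closed_dim (F : {vspace W}) :
  cross_closed F -> F != fullv -> ((\dim F).*2.+1 <= \dim {:W})%N.
Proof.
move=> Fc Ff; have Fo0 : orthv dot F != 0%VS.
  by apply: contra_neq Ff => o0; rewrite -(addv_orthv dotP F) o0 addv0.
have [|Go dG] := cross_closed_orth Fc (memv_pick (orthv dot F)).
  by rewrite vpick0.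
by rewrite -(dim_orthv dotP F) -addnn -addnS leq_add2l -dG dimvS.
Qed.

(** Imaginary parts of a quaternion subalgebra: [cross_double] brings the products with [cross x y]
    back to combinations of x and y, and [cross x y] is orthogonal to both. *)
Lemma cross_closed_span (x y : W) (G := (<[x]> + <[y]> + <[cross x y]>)%VS) :
  cross x y != 0 -> cross_closed G /\ \dim G = 3%N.
Proof.
move=> xy0; split; last first.
  have xyz : ((<[x]> + <[y]>) :&: <[cross x y]> = 0)%VS.
    apply/eqP; rewrite -subv0; apply/subvP => z /memv_capP[].
    move=> /memv_addP[_ /vlineP[a ->] [_ /vlineP[b ->] zE]] /vlineP[c zc].
    rewrite memv0 -(dot_eq0 dotP) {1}zc zE !(dotE dotP) (cross_orth crossP) cross_orthr.
    by rewrite !(mulr0, addr0).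
  have xy : (<[x]> :&: <[y]> = 0)%VS.
    apply/eqP; rewrite -subv0; apply/subvP => _ /memv_capP[/vlineP[a ->] /vlineP[b e]].
    rewrite memv0 scaler_eq0; apply/orP; left; apply: contraNT xy0 => a0.
    have : a *: cross x y = 0 by rewrite -crossZl e crossZl crossxx scaler0.
    by move/eqP; rewrite scaler_eq0 (negbTE a0).
  have x0 : x != 0 by apply: contra_neq xy0 => ->; rewrite cross0l.
  have y0 : y != 0 by apply: contra_neq xy0 => ->; rewrite cross0r.
  by rewrite !dimv_disjoint_sum// !dim_vline xy0 x0 y0.
have xG : x \in G by rewrite (subvP (addvSl _ _))// (subvP (addvSl _ _))// memv_line.
have yG : y \in G by rewrite (subvP (addvSl _ _))// (subvP (addvSr _ _))// memv_line.
have zG : cross x y \in G by rewrite (subvP (addvSr _ _))// memv_line.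
have xzG : cross x (cross x y) \in G by rewrite (cross_double crossP) memvB ?memvZ.
have yzG : cross y (cross x y) \in G.
  by rewrite (crossNC x) crossNr memvN (cross_double crossP) memvB ?memvZ.
have memG p : p \in G -> exists a b c, p = a *: x + b *: y + c *: cross x y.
  case/memv_addP=> _ /memv_addP[_ /vlineP[a ->] [_ /vlineP[b ->] ->]].
  by case=> _ /vlineP[c ->] ->; exists a, b, c.
move=> _ _ /memG[a [b [c ->]]] /memG[a' [b' [c' ->]]].
rewrite !crossE !crossxx (crossNC y x) (crossNC (cross x y) x) (crossNC (cross x y) y).
by rewrite !(memvD, memvZ, memvN) ?mem0v.
Qed.

Lemma cross_closed_dim_ge3 (F : {vspace W}) x y :
  cross_closed F -> x \in F -> y \in F -> cross x y != 0 -> (3 <= \dim F)%N.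
Proof.
move=> Fc xF yF xy0; have [_ <-] := cross_closed_span xy0.
by rewrite dimvS// !subv_add -!memvE xF yF Fc.
Qed.

End CrossProduct.

(** * Automorphisms commuting with s and closed s-stable subspaces *)

Section CrossAutomorphisms.
Context {R : realType} {W : vectType R}.
Variables (dot : W -> W -> R) (cross : W -> W -> W).
Hypothesis crossP : cross_product dot cross.
Hypothesis dimW : \dim {:W} = 7%N.
Let dotP : inner_product dot := cross_inner crossP.

Definition cross_automorphism (sigma : 'End(W)) : Prop :=
  (forall x y, dot (sigma x) (sigma y) = dot x y) /\
  (forall x y, sigma (cross x y) = cross (sigma x) (sigma y)).

Let dim_orthv3 (F : {vspace W}) : \dim F = 3%N -> \dim (orthv dot F) = 4%N.
Proof.
by move=> F3; apply: (@addnI 3%N); rewrite -{1}F3 (dim_orthv dotP F) dimW.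
Qed.

(** Both spaces having dimension 4, the complement of F is the doubling space of g, so h = a g +
    cross g f with f in F. As g is orthogonal to f, [cross_double] gives cross g h = - <g, g> f. *)
Lemma cross_orth_orth (F : {vspace W}) g h :
  cross_closed cross F -> \dim F = 3%N ->
  g \in orthv dot F -> h \in orthv dot F -> cross g h \in F.
Proof.
move=> Fc F3 go ho; have [->|g0] := eqVneq g 0.
  by rewrite (cross0l crossP) mem0v.
have [GF dG] := cross_closed_orth crossP Fc go g0.
have /eqP GE : (<[g]> + cross_end cross g @: F)%VS == orthv dot F.
  by rewrite eqEdim GF dG dim_orthv3 ?F3.
have := ho; rewrite -GE => /memv_addP[_ /vlineP[a ->] [_ /memv_imgP[f fF ->] ->]].
rewrite (crossDr crossP) (crossZr crossP) (crossxx crossP) scaler0 add0r.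
rewrite (cross_endE crossP) (cross_double crossP).
by have /(mem_orthv dotP) -> // := go; rewrite scale0r sub0r memvN memvZ.
Qed.

(* The automorphism is 1 on F and -1 on the orthogonal complement of F. *)
Lemma cross_reflection (s : 'End(W)) (F : {vspace W}) :
  symmetric_end dot s -> cross_closed cross F -> \dim F = 3%N ->
  (forall x, x \in F -> s x \in F) ->
  exists sigma : 'End(W), [/\ cross_automorphism sigma,
    (forall x, sigma (s x) = s (sigma x)) & sigma != \1%VF].
Proof.
move=> sS Fc F3 sF; pose H := orthv dot F.
have FH : (F :&: H = 0)%VS := orthv_cap dotP F.
have HF : (H :&: F = 0)%VS by rewrite capvC.
pose sigma := daddv_pi F H - daddv_pi H F.
have sigmaE f h : f \in F -> h \in H -> sigma (f + h) = f - h.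
  move=> fF hH.
  rewrite add_lfunE opp_lfunE !linearD/= (daddv_pi_id FH fF) (daddv_pi_id HF hH).
  have e1 : daddv_pi F H h = 0.
    have := daddv_pi_add FH (memv_add (mem0v F) hH).
    by rewrite add0r (daddv_pi_id HF hH) => /(canRL (addrK _)); rewrite subrr.
  have e2 : daddv_pi H F f = 0.
    have := daddv_pi_add HF (memv_add (mem0v H) fF).
    by rewrite add0r (daddv_pi_id FH fF) => /(canRL (addrK _)); rewrite subrr.
  by rewrite e1 e2 addr0 oppr0 add0r.
have dec x : exists f h, [/\ f \in F, h \in H & x = f + h].
  have : x \in (F + H)%VS by rewrite (addv_orthv dotP) memvf.
  by case/memv_addP=> f fF [h hH ->]; exists f, h.
have dotFH f h : f \in F -> h \in H -> dot f h = 0.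
  by move=> fF /(mem_orthv dotP) h0; rewrite (dotC dotP) h0.
have sH h : h \in H -> s h \in H.
  move=> /(mem_orthv dotP) h0; apply/(mem_orthv dotP) => f fF.
  by rewrite sS h0 ?sF.
have crossFH f h : f \in F -> h \in H -> cross f h \in H.
  move=> fF /(mem_orthv dotP) h0; apply/(mem_orthv dotP) => f' fF'.
  by rewrite (crossNC crossP) (dotNl dotP) (cross_triple crossP) h0 ?Fc ?oppr0.
exists sigma; split; first split.
- move=> x y; have [f [h [fF hH ->]]] := dec x; have [f' [h' [fF' hH' ->]]] := dec y.
  rewrite !sigmaE// !(dotE dotP) (dotC dotP h f') (dotFH f h')// (dotFH f' h)//; ring.
- move=> x y; have [f [h [fF hH ->]]] := dec x; have [f' [h' [fF' hH' ->]]] := dec y.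
  (* The product is graded modulo 2, with F even and H odd: the first bracket lies in F and the
     second in H. *)
  have -> : cross (f + h) (f' + h') =
      (cross f f' + cross h h') + (cross f h' + cross h f').
    by rewrite !(crossE crossP) [RHS]addrACA (addrC (cross h h')).
  rewrite !sigmaE//.
    by rewrite (crossBl crossP) !(crossBr crossP) opprB addrACA opprD.
    by apply: memvD; [apply: Fc | apply: (cross_orth_orth Fc)].
  by apply: memvD; [|rewrite (crossNC crossP) memvN]; apply: crossFH.
- move=> x; have [f [h [fF hH ->]]] := dec x.
  by rewrite sigmaE// linearB [s (f + h)]linearD sigmaE ?sF ?sH.
apply/lfunPn; have : H != 0%VS.
  by rewrite -dimv_eq0 dim_orthv3.
move=> H0; exists (vpick H); rewrite -[vpick H]add0r sigmaE ?mem0v ?memv_pick//.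
rewrite id_lfunE !add0r eq_sym -addr_eq0 -mulr2n -scaler_nat scaler_eq0.
by rewrite pnatr_eq0 vpick0.
Qed.

(* If sigma^2 <> 1, a common eigenvector v of s and sigma + sigma^-1 in
   im (sigma^2 - 1) spans with sigma v a sigma-stable plane on which s is a
   scalar, and u = v x sigma v is fixed by sigma; either u is an eigenvector
   of s, or the space of fixed points has dimension at least 3. If sigma^2 = 1,
   multiplication by some v with sigma v = -v maps the (-1)-eigenspace to the
   space of fixed points, so that the latter has dimension at least 3. *)
Lemma commuting_automorphism_closed (s sigma : 'End(W)) :
  symmetric_end dot s -> cross_automorphism sigma ->
  (forall x, sigma (s x) = s (sigma x)) -> sigma != \1%VF ->
  exists F : {vspace W}, [/\ cross_closed cross F, \dim F = 3%N &
    (forall x, x \in F -> s x \in F)].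
Proof.
move=> sS [sigmaI sigmaM] sigmas sigma1.
pose F := lker (sigma - \1%VF).
have memF x : x \in F <-> sigma x = x.
  by split=> [/eqlfunP|e]; [|apply/eqlfunP]; rewrite id_lfunE.
have Fc : cross_closed cross F.
  by move=> x y /memF ex /memF ey; apply/memF; rewrite sigmaM ex ey.
have Fs x : x \in F -> s x \in F by move=> /memF ex; apply/memF; rewrite sigmas ex.
have Ff : F != fullv.
  apply: contra_neq sigma1 => Ff; apply/lfunP => x; rewrite id_lfunE.
  by apply/memF; rewrite Ff memvf.
(* The fixed space F is closed, s-stable and proper, hence of dimension at most 3; if it reaches 3
   it is the required subspace. *)
have F3 : (3 <= \dim F)%N -> exists F : {vspace W},
    [/\ cross_closed cross F, \dim F = 3%N & (forall x, x \in F -> s x \in F)].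
  move=> F3; exists F; split=> //; apply/eqP; rewrite eqn_leq F3 andbT.
  by have := cross_closed_dim crossP Fc Ff; rewrite dimW -addnn; lia.
pose V := limg (sigma \o sigma - \1)%VF.
have [V0|V0] := eqVneq V 0%VS.
  have sigma2 x : sigma (sigma x) = x.
    apply/eqP; rewrite -subr_eq0 -memv0 -V0.
    have -> : sigma (sigma x) - x = (sigma \o sigma - \1)%VF x.
      by rewrite add_lfunE opp_lfunE comp_lfunE id_lfunE.
    by rewrite memv_img ?memvf.
  pose E := lker (sigma + \1%VF).
  have memE x : x \in E <-> sigma x = - x.
    rewrite memv_ker add_lfunE id_lfunE addr_eq0.
    by split=> [/eqP|->].
  (* As sigma^2 = 1, any difference sigma w - w is negated by sigma. *)
  have /lfunPn[w] := sigma1; rewrite id_lfunE -subr_eq0 => v0.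
  set v := sigma w - w in v0.
  have vE : v \in E by apply/memE; rewrite linearB/= sigma2 opprB.
  clearbody v; have EF : (cross_end cross v @: E <= F)%VS.
    apply/subvP => _ /memv_imgP[x xE ->]; apply/memF.
    rewrite !(cross_endE crossP) sigmaM (memE _).1// (memE x).1//.
    by rewrite (crossNl crossP) (crossNr crossP) opprK.
  have Ek : (\dim (E :&: lker (cross_end cross v)) <= 1)%N.
    apply: (@leq_trans (\dim <[v]>)); last by rewrite dim_vline leq_b1.
    apply/dimvS/subvP => x /memv_capP[_].
    rewrite memv_ker (cross_endE crossP) => /eqP/(cross_eq0 crossP v0)[a ->].
    by rewrite memvZ ?memv_line.
  have FE : (F + E)%VS = fullv.
    apply/eqP; rewrite eqEsubv subvf; apply/subvP => x _.
    have -> : x = 2^-1 *: (x + sigma x) + 2^-1 *: (x - sigma x).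
      by rewrite -scalerDr addrACA subrr addr0 -mulr2n -scaler_nat scalerA
        mulVf ?scale1r ?pnatr_eq0.
    apply: memv_add; apply: memvZ; first by apply/memF; rewrite linearD/= sigma2 addrC.
    by apply/memE; rewrite linearB/= sigma2 opprB.
  (* Since W = F + E, dim F + dim E >= 7, while [cross v] maps E into F with kernel of dimension at
     most 1, so dim F >= dim E - 1. *)
  apply: F3; have := dimv_sum_cap F E; rewrite FE dimW.
  have := limg_ker_dim (cross_end cross v) E; have := dimvS EF.
  lia.
have sigmaK : lker sigma == 0%VS.
  apply/lker0P => x y e; apply: (dot_inj dotP) => z.
  by rewrite -sigmaI e sigmaI.
(* If sigma^2 x = x, then <sigma^2 w - w, x> = <sigma^2 w, sigma^2 x> - <w, x> = 0; taking x =
   sigma^2 w - w makes its norm vanish. *)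
have Vsigma2 x : x \in V -> sigma (sigma x) = x -> x = 0.
  move=> /memv_imgP[w _ xE] x2; apply/eqP; rewrite -(dot_eq0 dotP) {1}xE.
  rewrite add_lfunE opp_lfunE comp_lfunE id_lfunE (dotBl dotP).
  by rewrite -{1}x2 !sigmaI subrr.
have memV (g : 'End(W)) x : (forall x, g (sigma x) = sigma (g x)) -> x \in V -> g x \in V.
  move=> gs /memv_imgP[w _ ->]; apply/memv_imgP; exists (g w); first exact: memvf.
  by rewrite !add_lfunE !opp_lfunE !comp_lfunE !id_lfunE linearB/= !gs.
have [l [v1 [v1V v10 sv1]]] := symmetric_eigenvector_in dotP sS
  (fun x => memV s x (fun y => esym (sigmas y))) V0.
pose K := (V :&: lker (s - l *: \1%VF))%VS.
have memK x : x \in K <-> x \in V /\ s x = l *: x.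
  rewrite memv_cap; split=> [/andP[-> /eqlfunP]|[-> e]].
    by rewrite scale_lfunE id_lfunE.
  by apply/eqlfunP; rewrite scale_lfunE id_lfunE.
have K0 : K != 0%VS.
  by apply: contra_neq v10 => K0; apply/eqP; rewrite -memv0 -K0; apply/memK.
(* The inverse of an isometry is its adjoint, so [S] is symmetric; it commutes with s and sigma,
   hence preserves the eigenspace [K]. *)
pose S := sigma + (sigma^-1)%VF.
have SE x : S x = sigma x + sigma^-1%VF x by rewrite add_lfunE.
have sigmaVK x : sigma (sigma^-1%VF x) = x by exact: lker0_lfunVK.
have SS : symmetric_end dot S.
  move=> x y; rewrite !SE !(dotE dotP) addrC; congr (_ + _).
    by rewrite -sigmaI sigmaVK.
  by rewrite -[RHS]sigmaI sigmaVK.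
have VsV x : s (sigma^-1%VF x) = sigma^-1%VF (s x).
  by apply: (lker0P sigmaK); rewrite sigmas !sigmaVK.
have [|c [v [/memK[vV sv] v0 Sv]]] := symmetric_eigenvector_in dotP SS _ K0.
  move=> x /memK[xV sx]; apply/memK; split.
    apply: memV xV => y; rewrite !SE linearD/= sigmaVK lker0_lfunK//.
  by rewrite !SE linearD/= -sigmas VsV sx !linearZ scalerDr.
pose u := cross v (sigma v).
(* Otherwise sigma v = a v, where a^2 = 1 because sigma is an isometry, so sigma^2 v = v, which
   [Vsigma2] excludes. *)
have u0 : u != 0.
  apply/eqP => /(cross_eq0 crossP v0)[a va]; move/eqP: (v0); apply.
  apply: Vsigma2 vV _; rewrite va linearZ/= va scalerA.
  have : dot (sigma v) (sigma v) = dot v v by rewrite sigmaI.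
  rewrite va !(dotE dotP) mulrA -[RHS]mul1r => /(mulIf _) ->; rewrite ?scale1r//.
  by rewrite (dot_eq0 dotP).
(* From S v = c v, sigma^2 v = c sigma v - v, and the term in sigma v drops out of the product with
   sigma v. *)
have su : sigma u = u.
  have s2v : sigma (sigma v) = c *: sigma v - v.
    by rewrite -linearZ -Sv SE linearD/= sigmaVK addrK.
  rewrite /u sigmaM s2v !(crossE crossP) (crossxx crossP) scaler0 add0r.
  by rewrite (crossNC crossP _ v) opprK.
have uF : u \in F by apply/memF.
have [usu|usu] := eqVneq (cross u (s u)) 0; last first.
  by apply: F3; apply: (cross_closed_dim_ge3 crossP Fc uF (Fs _ uF)) usu.
have [a sua] := cross_eq0 crossP u0 usu.
have [Gc G3] := cross_closed_span crossP u0.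
exists (<[v]> + <[sigma v]> + <[u]>)%VS; split=> //.
move=> x /memv_addP[y /memv_addP[_ /vlineP[b ->] [_ /vlineP[d ->] ->]]
  [_ /vlineP[e ->] ->]].
have ssv : s (sigma v) = l *: sigma v by rewrite -sigmas sv linearZ.
rewrite !linearD/= !linearZ/= sv ssv sua.
by apply: memv_add; [apply: memv_add|]; do 2!apply: memvZ; exact: memv_line.
Qed.

End CrossAutomorphisms.

(** * Determinants of left multiplications *)

Lemma lin1_mxE {R : realType} m n (f : 'rV[R]_m -> 'rV[R]_n) :
  linear f -> forall u, u *m lin1_mx f = f u.
Proof.
move=> lf u; pose h := GRing.isLinear.Build _ _ _ _ f lf.
by pose g : {linear 'rV[R]_m -> 'rV[R]_n} := HB.pack f h; exact: (mul_rV_lin1 g).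
Qed.

Section Determinant.
Context {R : realType} {W : vectType R}.
Notation Q := (qcarrier (W := W)).
Import VectorInternalTheory.

(** The scalar coordinate comes first, so that triangular operators on R1 + W become block
    triangular matrices. *)
Definition qcoord (p : Q) : 'rV[R]_(1 + dim W) :=
  row_mx (p.1%:M) (v2r p.2).

Definition qvec (w : 'rV[R]_(1 + dim W)) : Q :=
  (lsubmx w 0 0, r2v (rsubmx w)).

Lemma qcoordK : cancel qcoord qvec.
Proof.
by case=> a x; rewrite /qvec /qcoord row_mxKl row_mxKr v2rK !mxE eqxx.
Qed.

Lemma qvecK : cancel qvec qcoord.
Proof. by move=> w; rewrite /qcoord /qvec /= r2vK -mx11_scalar hsubmxK. Qed.

Definition qmx (f : 'End(Q)) : 'M[R]_(1 + dim W) :=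
  lin1_mx (qcoord \o f \o qvec).

Lemma qmxE (f : 'End(Q)) w : w *m qmx f = qcoord (f (qvec w)).
Proof.
have lf : linear (qcoord \o f \o qvec).
  move=> a u v /=; have -> : qvec (a *: u + v) = a *: qvec u + qvec v.
    by apply: injective_projections; [rewrite /= !mxE | rewrite /= !linearP].
  rewrite linearP; set p := f _; set q := f _.
  by rewrite /qcoord scale_row_mx add_row_mx !linearP /= scale_scalar_mx -raddfD.
exact: lin1_mxE lf w.
Qed.

Definition qdet (f : 'End(Q)) : R := \det (qmx f).

Lemma qmx_eq (f : 'End(Q)) (A : 'M[R]_(1 + dim W)) :
  (forall w, w *m A = qcoord (f (qvec w))) -> qmx f = A.
Proof. by move=> fA; apply/row_matrixP => i; rewrite !rowE qmxE fA. Qed.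

Lemma qdet_comp (f g : 'End(Q)) : qdet (f \o g)%VF = qdet g * qdet f.
Proof.
rewrite /qdet -det_mulmx; congr (\det _); apply: qmx_eq => w.
by rewrite mulmxA !qmxE qcoordK comp_lfunE.
Qed.

Lemma qdet_scale a : qdet (a *: \1%VF) = a ^+ (1 + dim W).
Proof.
rewrite -det_scalar; congr (\det _); apply: qmx_eq => w.
rewrite mul_mx_scalar scale_lfunE id_lfunE -{1}[w]qvecK.
case: (qvec w) => b x.
by rewrite /qcoord/= scale_row_mx linearZ/= scale_scalar_mx.
Qed.

Lemma qdet_neq0 (f : 'End(Q)) : lker f == 0%VS -> qdet f != 0.
Proof.
move=> f0; have : qdet (f^-1 \o f)%VF = 1.
  by rewrite (lker0_compVf f0) -[\1%VF]scale1r qdet_scale expr1n.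
by rewrite qdet_comp => e; apply: contra_eq_neq e => ->; rewrite mul0r eq_sym oner_neq0.
Qed.

Definition qupper (a : R) (v : W) : 'End(Q) :=
  linfun (fun p : Q => (a * p.1, p.1 *: v + p.2) : Q).

Lemma qupperE a v p : qupper a v p = (a * p.1, p.1 *: v + p.2).
Proof.
rewrite linfunE// => b p1 p2; apply: injective_projections => /=.
  by rewrite /GRing.scale/=; ring.
by rewrite scalerDr scalerDl scalerA addrACA.
Qed.

Lemma qdet_upper a v : qdet (qupper a v) = a.
Proof.
have -> : qdet (qupper a v) = \det (block_mx a%:M (v2r v) 0 1%:M : 'M_(1 + dim W)).
  congr (\det _); apply: qmx_eq => w; rewrite qupperE -{1}[w]qvecK.
  case: (qvec w) => b x; rewrite /qcoord mul_row_block /= !mulmx0 addr0 mulmx1.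
  by rewrite -scalar_mxM mul_scalar_mx linearD linearZ/= mulrC.
by rewrite det_ublock det_scalar1 det1 mulr1.
Qed.

End Determinant.

Section LeftMultiplication.
Import VectorInternalTheory.
Context {R : realType} {W : vectType R}.
Variables (dot : W -> W -> R) (cross : W -> W -> W).
Hypothesis crossP : cross_product dot cross.
Let dotP : inner_product dot := cross_inner crossP.
Notation Q := (qcarrier (W := W)).

(** The transpose of [qupper a v] for the inner product a b + <x, y> on R1 + W. *)
Definition qlower (a : R) (v : W) : 'End(Q) :=
  linfun (fun p : Q => (a * p.1 + dot v p.2, p.2) : Q).

Lemma qlowerE a v p : qlower a v p = (a * p.1 + dot v p.2, p.2).
Proof.
rewrite linfunE// => b p1 p2; apply: injective_projections => //=.
by rewrite !(dotE dotP) /GRing.scale/=; ring.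
Qed.

Lemma qdet_lower a v : qdet (qlower a v) = a.
Proof.
pose l (w : 'rV[R]_(dim W)) : 'rV[R]_1 := (dot v (r2v w))%:M.
have ll : linear l.
  move=> b x y; rewrite /l scale_scalar_mx -raddfD; congr (_%:M).
  by rewrite linearP !(dotE dotP).
have -> : qdet (qlower a v) =
    \det (block_mx a%:M 0 (lin1_mx l) 1%:M : 'M_(1 + dim W)).
  congr (\det _); apply: qmx_eq => w; rewrite qlowerE -{1}[w]qvecK.
  case: (qvec w) => b x; rewrite /qcoord mul_row_block /= mulmx0 add0r mulmx1.
  rewrite -scalar_mxM (lin1_mxE ll) /l v2rK -raddfD /=.
  by rewrite mulrC.
by rewrite det_lblock det_scalar1 det1 mulr1.
Qed.

Definition qext (f : 'End(W)) : 'End(Q) := linfun (fun p : Q => (p.1, f p.2) : Q).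

Lemma qextE f p : qext f p = (p.1, f p.2).
Proof.
rewrite linfunE// => b p1 p2; apply: injective_projections => //=.
by rewrite linearP.
Qed.

Lemma lker_qext f : lker f == 0%VS -> lker (qext f) == 0%VS.
Proof.
move=> /lker0P fI; apply/lker0P => -[a x] [b y]; rewrite !qextE /=.
by case=> -> /fI ->.
Qed.

(* Left multiplication by x in the algebra O(s), for symmetric s. *)
Definition qleft (s : 'End(W)) (x : W) : 'End(Q) :=
  linfun (fun p : Q => (- dot x p.2, p.1 *: x + s (cross (s x) (s p.2))) : Q).

Lemma qleftE s x p :
  qleft s x p = (- dot x p.2, p.1 *: x + s (cross (s x) (s p.2))).
Proof.
rewrite linfunE// => b p1 p2; apply: injective_projections => //=.
  by rewrite !(dotE dotP) /GRing.scale/=; ring.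
rewrite linearP !(crossE crossP) linearP scalerDr scalerDl scalerA.
by rewrite addrACA.
Qed.

(** In O, u (u p) = u^2 p: by [cross_double] the operator squares to the scalar - <u, u>. *)
Lemma qdet_left1 u : qdet (qleft \1%VF u) ^+ 2 = (- dot u u) ^+ (1 + dim W).
Proof.
rewrite expr2 -qdet_comp -qdet_scale; congr qdet; apply/lfunP => -[a x].
rewrite comp_lfunE !qleftE scale_lfunE !id_lfunE /=.
apply: injective_projections => /=.
  rewrite !(dotE dotP) (dotC dotP u (cross _ _)) (cross_orth crossP).
  by rewrite /GRing.scale/=; ring.
rewrite !(crossE crossP) (crossxx crossP) (cross_double crossP).
by rewrite scaler0 add0r scaleNr addKr scaleNr.
Qed.

(* With u = s x, the left multiplications in O(s) and O are related by
   qleft s x = P^T (qext s) (qleft 1 u) (qext s) P, where P is the upper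
   triangular operator with diagonal entries a and 1. *)
Lemma qdet_left (s : 'End(W)) (x : W) :
  lker s == 0%VS -> symmetric_end dot s -> x != 0 ->
  qdet (qleft s x) =
  (dot x x / dot (s x) (s x)) ^+ 2 * qdet (qext s) ^+ 2 * qdet (qleft \1%VF (s x)).
Proof.
move=> s0 sS x0; set u := s x; set a := dot x x / dot u u.
have sVK y : s (s^-1%VF y) = y by exact: lker0_lfunVK.
have u0 : u != 0.
  by apply: contra_neq x0 => u0; apply: (lker0P s0); rewrite linear0.
have uu0 : dot u u != 0 by rewrite (dot_eq0 dotP).
have [w sw] : exists w, s w = x by exists (s^-1%VF x).
(* The images of (1, 0) must agree, which requires x = a (s u) + s (cross u (s v)). With s w = x and
   <u, w> = <x, x>, [cross_double] yields this v. *)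
have [v vE] : exists v, s v = - (dot u u)^-1 *: cross u w.
  by exists (s^-1%VF (- (dot u u)^-1 *: cross u w)).
have sv : s (cross u (s v)) = x - a *: s u.
  rewrite vE (crossZr crossP) (cross_double crossP).
  rewrite scalerBr !scalerA !mulNr mulVf// scaleN1r opprK.
  rewrite linearD/= sw linearZ/= addrC scaleNr; congr (_ - _ *: _).
  have -> : dot u w = dot x x by rewrite sS sw.
  exact: mulrC.
have -> : qleft s x =
    (qlower a v \o (qext s \o (qleft \1%VF u \o (qext s \o qupper a v))))%VF.
  apply/lfunP => -[b y]; rewrite !comp_lfunE qlowerE !qextE !qleftE !id_lfunE.
  rewrite qupperE /=; apply: injective_projections => /=.
    have xE : x = s (cross u (s v)) + a *: s u by rewrite sv subrK.
    have svE : dot (s v) (cross u (s y)) = - dot (s (cross u (s v))) y.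
      by rewrite -(cross_triple crossP) (crossNC crossP) (dotNl dotP) -sS.
    have xy : dot x y = dot (s (cross u (s v))) y + a * dot u (s y).
      by rewrite {1}xE (dotDl dotP) (dotZl dotP) (sS u).
    rewrite xy -(sS v) linearP (crossDr crossP) (crossZr crossP) !(dotE dotP) svE.
    rewrite (dotC dotP (s v) (cross _ _)) (cross_orthr crossP) (dotC dotP (s v) u).
    by ring.
  have sE : s (cross u (s (b *: v + y))) = b *: (x - a *: s u) + s (cross u (s y)).
    by rewrite linearP (crossDr crossP) (crossZr crossP) linearP /= sv.
  rewrite linearD/= linearZ/= sE scalerBr scalerA mulrC addrA.
  by rewrite [_ *: s u + _]addrC subrK.
by rewrite !qdet_comp qdet_upper qdet_lower; ring.
Qed.

End LeftMultiplication.

(** * Automorphisms of O(s) commute with s *)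

Section TwistedAutomorphisms.
Context {R : realType} {W : vectType R}.
Variables (dot : W -> W -> R) (cross : W -> W -> W).
Hypothesis crossP : cross_product dot cross.
Hypothesis dimW : \dim {:W} = 7%N.
Let dotP : inner_product dot := cross_inner crossP.
Variable s : 'End(W).
Hypotheses (s0 : lker s == 0%VS) (sS : symmetric_end dot s)
  (sP : posdef_end dot s).
Variable sigma : 'End(W).
Hypotheses (sigmaI : forall x y, dot (sigma x) (sigma y) = dot x y)
  (sigmaM : forall x y,
     sigma (s (cross (s x) (s y))) = s (cross (s (sigma x)) (s (sigma y)))).

Let sigma0 : lker sigma == 0%VS.
Proof.
by apply/lker0P => x y e; apply: (dot_inj dotP) => z; rewrite -sigmaI e sigmaI.
Qed.

(** Squaring is forced by [qdet_left1], which leaves the sign of the determinant undetermined; the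
    exponent there is 8. *)
Let sqr_qdet_left x : x != 0 -> qdet (qleft dot cross s x) ^+ 2 =
  (dot x x * dot (s x) (s x)) ^+ 4 * qdet (qext s) ^+ 4.
Proof.
move=> x0.
rewrite (qdet_left crossP s0 sS x0) !exprMn (qdet_left1 crossP) -dimvf dimW.
have sx0 : dot (s x) (s x) != 0.
  rewrite (dot_eq0 dotP); apply: contra_neq x0 => sx0.
  by apply: (lker0P s0); rewrite sx0 linear0.
by field.
Qed.

(** Left multiplications by x and sigma x are conjugate under [qext sigma], so their determinants
    agree. The factor <x, x>^4 is preserved and cancels, and fourth roots of nonnegative reals are
    unique. *)
Let sigma_norm x : dot (s (sigma x)) (s (sigma x)) = dot (s x) (s x).
Proof.
have [->|x0] := eqVneq x 0; first by rewrite !linear0.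
have sx0 : sigma x != 0.
  by apply: contra_neq x0 => e; apply: (lker0P sigma0); rewrite e linear0.
have : qdet (qleft dot cross s (sigma x)) = qdet (qleft dot cross s x).
  apply: (mulfI (qdet_neq0 (lker_qext sigma0))).
  rewrite [RHS]mulrC -!qdet_comp; congr qdet; apply/lfunP => -[a y].
  rewrite !comp_lfunE !qextE !(qleftE crossP) /=.
  by rewrite sigmaI linearD/= linearZ/= sigmaM.
move/(congr1 (fun d => d ^+ 2)); rewrite !sqr_qdet_left// sigmaI.
move/(mulIf (expf_neq0 4 (qdet_neq0 (lker_qext s0)))).
rewrite !exprMn => /(mulfI _) e; apply: (pexpIrn (n := 4)) => //.
- by rewrite nnegrE (dot_ge0 dotP).
- by rewrite nnegrE (dot_ge0 dotP).
- by apply: e; rewrite expf_neq0// (dot_eq0 dotP).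
Qed.

Let sigma_dot x y : dot (s (sigma x)) (s (sigma y)) = dot (s x) (s y).
Proof.
have := sigma_norm (x + y); rewrite !linearD/= !(dotE dotP) !sigma_norm.
rewrite (dotC dotP (s y)) (dotC dotP (s (sigma y))); lra.
Qed.

(** The conjugate t = sigma^-1 s sigma is again symmetric and positive definite, and t^2 = s^2
    because sigma preserves <s x, s y>; uniqueness of the square root gives t = s. *)
Lemma twisted_commute x : sigma (s x) = s (sigma x).
Proof.
pose t := (sigma^-1 \o (s \o sigma))%VF.
have sigmaVK y : sigma (sigma^-1%VF y) = y by exact: lker0_lfunVK.
have tE y : t y = sigma^-1%VF (s (sigma y)) by rewrite !comp_lfunE.
have dott y z : dot (t y) z = dot (s (sigma y)) (sigma z).
  by rewrite tE -sigmaI sigmaVK.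
have tS : symmetric_end dot t.
  by move=> y z; rewrite dott [RHS](dotC dotP) dott sS (dotC dotP).
have tP : posdef_end dot t.
  move=> y y0; rewrite dott; apply: sP; apply: contra_neq y0 => e.
  by apply: (lker0P sigma0); rewrite e linear0.
have tt y : s (s y) = t (t y).
  apply: (dot_inj dotP) => z.
  by rewrite sS -sigma_dot -sS dott {1}tE sigmaVK.
by rewrite {1}(posdef_sqrt_unique dotP sS sP tS tP tt) tE sigmaVK.
Qed.

(** Once sigma commutes with s, the twisted identity at s^-1 x and s^-1 y gives the untwisted one,
    after cancelling the outer s. *)
Lemma twisted_cross_automorphism : cross_automorphism dot cross sigma.
Proof.
split=> // x y.
have sVK z : s (s^-1%VF z) = z by exact: lker0_lfunVK.
apply: (lker0P s0); rewrite -twisted_commute -[x in LHS]sVK -[y in LHS]sVK sigmaM.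
by rewrite -!twisted_commute !sVK.
Qed.

End TwistedAutomorphisms.

(** * The algebras O(s) *)

Section Quadratic.
Context {R : realType} {W : vectType R}.
Variables (form : W -> W -> R) (star : W -> W -> W).
Notation dot := (fun x y => - form x y).
Hypothesis starP : cross_product dot star.
Hypothesis dimW : \dim {:W} = 7%N.
Let dotP : inner_product dot := cross_inner starP.
Notation Q := (qcarrier (W := W)).

Let formE x y : form x y = - dot x y. Proof. by rewrite opprK. Qed.

Let form0l y : form 0 y = 0.
Proof. by rewrite formE (dot0l dotP) oppr0. Qed.

Let form0r x : form x 0 = 0.
Proof. by rewrite formE (dot0r dotP) oppr0. Qed.

Lemma form_anti_eq0 a x : a ^+ 2 + dot x x = 0 -> a = 0 /\ x = 0.
Proof.
move=> /eqP; rewrite paddr_eq0 ?sqr_ge0 ?(dot_ge0 dotP)// sqrf_eq0.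
by rewrite (dot_eq0 dotP) => /andP[/eqP -> /eqP ->].
Qed.

(** Since s is an adjoint of itself, [xget] does not return its default, and by nondegeneracy
    whatever it returns is s. *)
Lemma adjoint_symmetric (s : 'End(W)) : symmetric_end dot s -> adjoint form s = s.
Proof.
move=> sS; rewrite /adjoint; case: xgetP => [g _ /= gs|/(_ s)[]]; last first.
  by move=> x y; apply: oppr_inj; exact: sS.
apply/lfunP => y; apply: (dot_inj dotP) => z.
by rewrite !(dotC dotP _ z) -gs; exact: sS.
Qed.

Definition qone : Q := (1, 0).

Definition qim : 'Hom(Q, W) := linfun (snd : Q -> W).

Lemma qimE p : qim p = p.2. Proof. by rewrite linfunE. Qed.

Lemma lker_qim : lker qim = <[qone]>%VS.
Proof.
apply/vspaceP => -[a x]; rewrite memv_ker qimE /=; apply/eqP/vlineP.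
  move=> ->; exists a; apply: injective_projections => /=; last by rewrite scaler0.
  by rewrite /GRing.scale/= mulr1.
by case=> b /(congr1 snd)/= ->; rewrite scaler0.
Qed.

Lemma qone_neq0 : qone != 0.
Proof. by apply/eqP => /(congr1 fst) /= /eqP; rewrite oner_eq0. Qed.

(* x^2 = 2 Re(x) x - N(x) 1, so a nonzero subalgebra contains 1. *)
Lemma subalgebra_qone (U : {vspace Q}) :
  subalgebra (qmul form star) U -> U != 0%VS -> qone \in U.
Proof.
move=> Ualg; rewrite -vpick0; have := memv_pick U.
case: (vpick U) => a x pU p0.
have c0 : a ^+ 2 + dot x x != 0.
  by apply: contra_neq p0 => /form_anti_eq0[-> ->].
have -> : qone = (a ^+ 2 + dot x x)^-1 *:
    ((2 * a) *: ((a, x) : Q) - qmul form star (a, x) (a, x)).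
  apply: injective_projections => /=.
    by rewrite /GRing.scale/=; field; apply: contra_neq c0 => <-; ring.
  by rewrite (crossxx starP) addr0 -scalerDl mulr_natl mulr2n subrr scaler0.
by rewrite memvZ ?memvB ?memvZ ?Ualg.
Qed.

(** A nonzero subalgebra U contains 1, so it is R1 + F with F its projection to W; conversely R1 + F
    is the preimage of F. The kernel R1 of the projection accounts for the shift from 4 to 3. *)
Lemma stable_subalgebraP (s : 'End(W)) :
  (exists U : {vspace Q}, [/\ subalgebra (qmul form star) U, \dim U = 4%N
     & forall x, x \in U -> ext s x \in U]) <->
  (exists F : {vspace W}, [/\ cross_closed star F, \dim F = 3%N
     & forall x, x \in F -> s x \in F]).
Proof.
split=> [[U [Ualg U4 sU]]|[F [Fc F3 sF]]].
  have oneU : qone \in U by rewrite subalgebra_qone// -dimv_eq0 U4.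
  have memF x : x \in (qim @: U)%VS -> ((0, x) : Q) \in U.
    move=> /memv_imgP[p pU ->]; have -> : (0, qim p) = p - p.1 *: qone.
      rewrite qimE; apply: injective_projections => /=.
        by rewrite /GRing.scale/= mulr1 subrr.
      by rewrite scaler0 subr0.
    by rewrite memvB ?memvZ.
  exists (qim @: U)%VS; split.
  - move=> x y /memF xU /memF yU; apply/memv_imgP.
    exists (qmul form star (0, x) (0, y)); first exact: Ualg.
    by rewrite qimE /= !scale0r !add0r.
  - have := limg_ker_dim qim U; rewrite lker_qim U4.
    have /capv_idPr -> : (<[qone]> <= U)%VS by rewrite -memvE.
    by rewrite dim_vline qone_neq0 add1n => -[].
  - move=> x /memF /sU xU; apply/memv_imgP; exists (ext s (0, x)) => //.
    by rewrite qimE.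
exists (qim @^-1: F)%VS; split.
- move=> p q; rewrite -!memv_preim !qimE /= => pF qF.
  by rewrite !memvD ?memvZ ?Fc.
- rewrite -(limg_ker_dim qim) lker_qim lpreimK.
    rewrite F3 (_ : (_ :&: _)%VS = <[qone]>%VS) ?dim_vline ?qone_neq0//.
    by apply/capv_idPr; rewrite -memvE -memv_preim qimE mem0v.
  apply/subvP => x xF; apply/memv_imgP; exists (0, x); first exact: memvf.
  by rewrite qimE.
- by move=> p; rewrite -!memv_preim !qimE; exact: sF.
Qed.

(** * Automorphisms of O(s) in terms of isometries of W *)

Section Automorphisms.
Variable s : 'End(W).
Hypotheses (s0 : lker s = 0%VS) (sS : symmetric_end dot s)
  (sP : posdef_end dot s).
Let mul := qmul form (twist form star s).

Let twistE x y : twist form star s x y = s (star (s x) (s y)).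
Proof. by rewrite /twist adjoint_symmetric. Qed.

(* An automorphism fixes 1, hence preserves W, which consists of 0 and the
   nonscalars with scalar square. *)
Lemma Aut_twist_im (f : 'End(Q)) : Aut mul f ->
  exists sigma : 'End(W), [/\ f = qext sigma,
    (forall x y, dot (sigma x) (sigma y) = dot x y) &
    (forall x y,
       sigma (s (star (s x) (s y))) = s (star (s (sigma x)) (s (sigma y))))].
Proof.
case=> /eqP f0 fM.
have mul1 p : mul p qone = p.
  rewrite /mul /qmul twistE /= !linear0 (cross0r starP) linear0 scale1r form0r.
  rewrite !(addr0, add0r) mulr1.
  by case: p.
have mul1l p : mul qone p = p.
  rewrite /mul /qmul twistE /= !linear0 (cross0l starP) linear0 scale1r form0l.
  rewrite !(addr0, add0r) mul1r.
  by case: p.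
(* The image of 1 acts as a left unit on the range of f, which contains 1. *)
have f1 : f qone = qone.
  by rewrite -[f qone]mul1 -{2}(lker0_lfunVK f0 qone) -fM mul1l lker0_lfunVK.
have fre (a : R) : f (a, 0) = (a, 0).
  have -> : ((a, 0) : Q) = a *: qone.
    by apply: injective_projections => /=; rewrite ?scaler0// /GRing.scale/= mulr1.
  by rewrite linearZ/= f1.
pose sigma : 'End(W) := linfun (fun x : W => (f (0, x)).2).
have sigmaE x : sigma x = (f (0, x)).2.
  rewrite linfunE// => a u v.
  have -> : ((0, a *: u + v) : Q) = a *: (0, u) + (0, v).
    by apply: injective_projections => //=; rewrite scaler0 addr0.
  by rewrite linearP.
have mulim x y : mul (0, x) (0, y) = (form x y, s (star (s x) (s y))).
  by rewrite /mul /qmul twistE /= !scale0r mul0r !add0r.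
have fim x : f (0, x) = (0, sigma x).
  (* Write f (0, x) = (a, y). Its square is a scalar, so 2 a y = 0; and if y = 0, then a^2 = - <x,
     x> forces a = 0. *)
  rewrite sigmaE; apply: injective_projections => //=.
  have := fM (0, x) (0, x).
  rewrite mulim (crossxx starP) linear0 fre /mul /qmul twistE (crossxx starP) linear0.
  case: (f (0, x)) => a y /= [e /eqP].
  rewrite addr0 -scalerDl -mulr2n eq_sym scaler_eq0 mulrn_eq0/= => /orP[/eqP//|/eqP y0].
  apply: (form_anti_eq0 (x := x) _).1.
  by rewrite e y0 form0l addr0 -expr2; ring.
exists sigma; split=> [|x y|x y].
- apply/lfunP => -[a x]; rewrite qextE /=.
  have -> : ((a, x) : Q) = (a, 0) + (0, x).
    by apply: injective_projections; rewrite /= ?addr0 ?add0r.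
  by rewrite linearD/= fre fim; apply: injective_projections; rewrite /= ?addr0 ?add0r.
- have := fM (0, x) (0, y); rewrite !fim !mulim => /(congr1 fst) /=.
  have -> : ((form x y, s (star (s x) (s y))) : Q) =
      (form x y, 0) + (0, s (star (s x) (s y))).
    by apply: injective_projections; rewrite /= ?addr0 ?add0r.
  by rewrite linearD/= fre fim /= addr0 => ->.
have := fM (0, x) (0, y); rewrite !fim !mulim => /(congr1 snd) /=.
have -> : ((form x y, s (star (s x) (s y))) : Q) =
    (form x y, 0) + (0, s (star (s x) (s y))).
  by apply: injective_projections; rewrite /= ?addr0 ?add0r.
by rewrite linearD/= fre fim /= add0r.
Qed.

Lemma Aut_twist_qext (sigma : 'End(W)) :
  cross_automorphism dot star sigma -> (forall x, sigma (s x) = s (sigma x)) ->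
  Aut mul (qext sigma).
Proof.
case=> sigmaI sigmaM sigmas; split.
  apply/eqP/lker_qext/lker0P => x y e; apply: (dot_inj dotP) => z.
  by rewrite -sigmaI e sigmaI.
move=> p q; rewrite !qextE /mul /qmul !twistE /=; congr (_, _).
  by rewrite [form (sigma _) _]formE sigmaI opprK.
by rewrite !linearD/= !linearZ/= sigmas sigmaM !sigmas.
Qed.

Lemma Aut_twist_nontrivial :
  Aut mul <> [set \1%VF] <->
  exists F : {vspace W}, [/\ cross_closed star F, \dim F = 3%N
     & forall x, x \in F -> s x \in F].
Proof.
have qext1 : qext (\1%VF : 'End(W)) = \1%VF.
  by apply/lfunP => -[a x]; rewrite qextE !id_lfunE.
(* Knowing that the identity belongs to [Aut mul], a set other than the singleton must contain some
   f <> 1. *)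
have id_aut : Aut mul \1%VF.
  rewrite -qext1; apply: Aut_twist_qext => [|x]; last by rewrite !id_lfunE.
  by split=> x y; rewrite !id_lfunE.
split=> [|[F [Fc F3 sF]]].
  move=> A1.
  have [f fA f1] : exists2 f, Aut mul f & f != \1%VF.
    apply: contrapT => h; apply: A1; apply/seteqP; split=> [f fA|_ ->//].
    by apply: contrapT => f1; apply: h; exists f => //; apply/eqP.
  have [sigma [fE sigmaI sigmaM]] := Aut_twist_im fA.
  have s0' : lker s == 0%VS by rewrite s0.
  apply: (commuting_automorphism_closed starP dimW sS (sigma := sigma)).
  - exact: (twisted_cross_automorphism starP dimW s0' sS sP).
  - exact: (twisted_commute starP dimW s0' sS sP).
  - by apply: contra_neq f1 => sigma1; rewrite fE sigma1.
have [sigma [sigmaA sigmas sigma1]] := cross_reflection starP dimW sS Fc F3 sF.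
move=> A1; have := Aut_twist_qext sigmaA sigmas; rewrite A1 /= => e.
move/eqP: sigma1; apply; apply/lfunP => x; move/lfunP/(_ (0, x)): e.
by rewrite qextE !id_lfunE /= => -[].
Qed.

End Automorphisms.
End Quadratic.

(** * Octonions *)

Section Octonions.
Variable R : realType.
Notation W := (imO R).

Lemma mem_imO (z : octo R) : (z \in imO_vs R) = (octo_re z == 0).
Proof. by rewrite memv_ker linfunE. Qed.

Lemma octo_re_im (x : W) : octo_re (vsval x) = 0.
Proof. by apply/eqP; rewrite -mem_imO subvsP. Qed.

Lemma val_octo_im (z : octo R) : vsval (octo_im z) = z - octo_re z *: octo1 R.
Proof.
by rewrite vsprojK// mem_imO /octo_re /= /GRing.scale/= mulr1 subrr.
Qed.

(** Rank-nullity for the real part, from dimension 8 onto dimension 1. *)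
Lemma dim_imO : \dim {:W} = 7%N.
Proof.
pose re : 'Hom(octo R, R^o) := linfun ((fst \o fst) \o fst).
have reE z : re z = octo_re z by rewrite linfunE.
have re_img : limg re = fullv.
  apply/vspaceP => a; rewrite memvf; apply/memv_imgP.
  exists (a *: octo1 R); first exact: memvf.
  by rewrite reE /octo_re /= /GRing.scale/= mulr1.
have := limg_ker_dim re fullv; rewrite re_img capfv !dimvf => h.
by apply: (@addIn 1%N); rewrite -[RHS]h.
Qed.

Definition imO_val (a b c d e f g : R) : octo R :=
  (((0, a), (b, c)), ((d, e), (f, g))).

Lemma imO_coord (x : W) :
  exists a b c d e f g, vsval x = imO_val a b c d e f g.
Proof.
case: (vsval x) (octo_re_im x) => -[[x0 a] [b c]] [[d e] [f g]].
by rewrite /octo_re/= => ->; exists a, b, c, d, e, f, g.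
Qed.

Lemma imO_valP k (x y : W) : vsval (k *: x + y) = k *: vsval x + vsval y.
Proof. by []. Qed.

Lemma imO_valB p q (x y : W) :
  vsval (p *: x - q *: y) = p *: vsval x - q *: vsval y.
Proof. by []. Qed.

Lemma imO_valN (x : W) : vsval (- x) = - vsval x.
Proof. by []. Qed.

Ltac octo_ring :=
  repeat apply: injective_projections => /=; rewrite /GRing.scale /=; ring.

(** * The product of imaginary octonions in coordinates *)

Section Coordinates.
Context {x y : W} {a b c d e f g a' b' c' d' e' f' g' : R}.
Hypotheses (xE : vsval x = imO_val a b c d e f g)
  (yE : vsval y = imO_val a' b' c' d' e' f' g').

Let octo_mulE : octo_mul (imO_val a b c d e f g) (imO_val a' b' c' d' e' f' g') =
  (((- (a * a' + b * b' + c * c' + d * d' + e * e' + f * f' + g * g'),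
     b * c' + d * e' + g * f' - c * b' - e * d' - f * g'),
    (c * a' + d * f' + e * g' - a * c' - f * d' - g * e',
     a * b' + d * g' + f * e' - b * a' - e * f' - g * d')),
   ((e * a' + f * b' + g * c' - a * e' - b * f' - c * g',
     a * d' + c * f' + g * b' - b * g' - d * a' - f * c'),
    (a * g' + b * d' + e * c' - c * e' - d * b' - g * a',
     b * e' + c * d' + f * a' - a * f' - d * c' - e * b'))).
Proof.
rewrite /imO_val /octo_mul /quat_mul /cplx_mul /quat_conj /cplx_conj.
by rewrite /cd_mul /cd_conj /=; octo_ring.
Qed.

Lemma oform_coord : oform x y =
  - (a * a' + b * b' + c * c' + d * d' + e * e' + f * f' + g * g').
Proof. by rewrite /oform xE yE octo_mulE. Qed.

(** The seven oriented lines of the Fano plane are abc, ade, agf, bdf, beg, cdg, cfe; each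
    coordinate collects the three lines through it. *)
Lemma owedge_coord : vsval (owedge x y) = imO_val
  (b * c' + d * e' + g * f' - c * b' - e * d' - f * g')
  (c * a' + d * f' + e * g' - a * c' - f * d' - g * e')
  (a * b' + d * g' + f * e' - b * a' - e * f' - g * d')
  (e * a' + f * b' + g * c' - a * e' - b * f' - c * g')
  (a * d' + c * f' + g * b' - b * g' - d * a' - f * c')
  (a * g' + b * d' + e * c' - c * e' - d * b' - g * a')
  (b * e' + c * d' + f * a' - a * f' - d * c' - e * b').
Proof. by rewrite val_octo_im xE yE octo_mulE /imO_val /octo_re /=; octo_ring. Qed.

Lemma imO_linear_coord k : vsval (k *: x + y) = imO_val (k * a + a') (k * b + b')
  (k * c + c') (k * d + d') (k * e + e') (k * f + f') (k * g + g').
Proof. by rewrite imO_valP xE yE; octo_ring. Qed.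

End Coordinates.

(** In the seven coordinates every axiom is a polynomial identity, except positivity, where <x, x>
    is a sum of seven squares. *)
Lemma owedge_cross : cross_product (fun x y : W => - oform x y) (@owedge R).
Proof.
split; first split.
- move=> x y.
  have [a [b [c [d [e [f [g xE]]]]]]] := imO_coord x.
  have [a' [b' [c' [d' [e' [f' [g' yE]]]]]]] := imO_coord y.
  by rewrite (oform_coord xE yE) (oform_coord yE xE); ring.
- move=> k x y z.
  have [a [b [c [d [e [f [g xE]]]]]]] := imO_coord x.
  have [a' [b' [c' [d' [e' [f' [g' yE]]]]]]] := imO_coord y.
  have [u1 [u2 [u3 [u4 [u5 [u6 [u7 zE]]]]]]] := imO_coord z.
  rewrite (oform_coord (imO_linear_coord xE yE k) zE).
  by rewrite (oform_coord xE zE) (oform_coord yE zE); ring.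
- move=> x x0; have [a [b [c [d [e [f [g xE]]]]]]] := imO_coord x.
  rewrite (oform_coord xE xE) opprK lt0r !addr_ge0 -?expr2 ?sqr_ge0// andbT.
  apply: contra_neq x0 => /eqP.
  rewrite !paddr_eq0 ?addr_ge0 ?sqr_ge0// !sqrf_eq0.
  move=> /andP[/andP[/andP[/andP[/andP[/andP[/eqP a0 /eqP b0] /eqP c0] /eqP d0] /eqP e0]
    /eqP f0] /eqP g0].
  by apply: subvs_inj; rewrite xE a0 b0 c0 d0 e0 f0 g0.
- move=> k x y z; apply: subvs_inj.
  have [a [b [c [d [e [f [g xE]]]]]]] := imO_coord x.
  have [a' [b' [c' [d' [e' [f' [g' yE]]]]]]] := imO_coord y.
  have [u1 [u2 [u3 [u4 [u5 [u6 [u7 zE]]]]]]] := imO_coord z.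
  rewrite (owedge_coord (imO_linear_coord xE yE k) zE).
  rewrite (imO_linear_coord (owedge_coord xE zE) (owedge_coord yE zE)).
  by rewrite /imO_val; octo_ring.
- move=> x y; apply: subvs_inj.
  have [a [b [c [d [e [f [g xE]]]]]]] := imO_coord x.
  have [a' [b' [c' [d' [e' [f' [g' yE]]]]]]] := imO_coord y.
  rewrite [LHS](owedge_coord xE yE) [RHS]imO_valN.
  rewrite [X in _ = - X](owedge_coord yE xE).
  by rewrite /imO_val; octo_ring.
- move=> x y.
  have [a [b [c [d [e [f [g xE]]]]]]] := imO_coord x.
  have [a' [b' [c' [d' [e' [f' [g' yE]]]]]]] := imO_coord y.
  by rewrite (oform_coord (owedge_coord xE yE) xE); ring.
- move=> x y.
  have [a [b [c [d [e [f [g xE]]]]]]] := imO_coord x.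
  have [a' [b' [c' [d' [e' [f' [g' yE]]]]]]] := imO_coord y.
  apply: subvs_inj; rewrite [LHS](owedge_coord xE (owedge_coord xE yE)).
  rewrite [RHS]imO_valB xE yE (oform_coord xE yE) (oform_coord xE xE).
  by rewrite /imO_val; octo_ring.
Qed.

End Octonions.

Theorem mainTheorem14 (R : realType) (s : 'End(imO R))
    (s_aut : lker s = 0%VS)
    (s_sym : symmetric_end (fun x y => - oform x y) s)
    (s_pos : posdef_end (fun x y => - oform x y) s) :
  Aut (qmul (@oform R) (twist (@oform R) (@owedge R) s)) <> [set \1%VF]
  <->
  exists U : {vspace qcarrier (W := imO R)},
    [/\ subalgebra (qmul (@oform R) (@owedge R)) U,
        \dim U = 4%N
      & forall x, x \in U -> ext s x \in U].
Proof.
have starP := @owedge_cross R; have dimW := dim_imO R.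
rewrite (stable_subalgebraP starP s).
exact: (Aut_twist_nontrivial starP dimW s_aut s_sym s_pos).
Qed.
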